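(* Let $G$ be a graph on $[n]$. For each $3$-rigid minor $H$ of $G$ (together with the way it is obtained from $G$), pick a representative proper $3$-coloring $R_i$ from each connected component of the $3$-coloring graph $C_3(H)$, and for each $i>1$ take the element $$f=\left[\begin{array}{c} a_1 \\ a_2 \\ a_3 \end{array}\right]-\left[\begin{array}{c} b_1 \\ b_2 \\ b_3 \end{array}\right],$$ where $a_{jk}=1$ if either the vertex $k$ of $G$ is deleted in obtaining $H$ or its image in $H$ is colored with color $j$ in $R_1$, and $a_{jk}=0$ otherwise; and $b_{jk}=1$ if either $k$ is deleted or its image in $H$ is colored with color $j$ in $R_i$, and $b_{jk}=0$ otherwise. Then each of these elements $f$ is a minimal generator of $I_G$ of degree $3$, and these elements together with all elements equivalent to them and the quadratic binomials in $I_G$ generate $I_G$ up to degree $3$ (i.e. the ideal they generate contains every element of $I_G$ of degree at most $3$).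
   Context: Graphs are finite and simple. For a graph $G$ with vertex set $[n]$, edge set $E(G)$ and set of isolated vertices $Iso(G)$, $I_G$ is the kernel of the $\mathbb{C}$-algebra homomorphism $$\phi_G:\mathbb{C}[p_{i_1\cdots i_n}\mid i_j\in\{0,1\}]\to \mathbb{C}[t^{(j,k)}_{a,b},\,t^{(l)}_{a}\mid \{j,k\}\in E(G),\ l\in Iso(G),\ a,b\in\{0,1\}],$$ $$p_{i_1\cdots i_n}\mapsto \prod_{\{j,k\}\in E(G)}t^{(j,k)}_{i_j,i_k}\prod_{l\in Iso(G)}t^{(l)}_{i_l};$$ it is a homogeneous toric ideal. A homogeneous binomial of degree $d$ in $I_G$ is a minimal generator of $I_G$ if it is not in the ideal generated by the elements of $I_G$ of degree less than $d$. Tableau notation: a difference of two matrices with rows $a_1,\dots,a_d$ and $b_1,\dots,b_d$ (each a $0$-$1$ string of length $n$, with $k$-th entries $a_{jk}$, $b_{jk}$) stands for the binomial $\prod_j p_{a_j}-\prod_j p_{b_j}$. Two generators are equivalent if they lie in the same orbit under the action of $(\mathbb{Z}/2)^n\rtimes \mathrm{Aut}(G)$, where $(c_1,\dots,c_n)\in(\mathbb{Z}/2)^n$ sends $p_{i_1\cdots i_n}$ to $p_{j_1\cdots j_n}$ with $j_r=i_r+c_r$ in $\mathbb{Z}/2$, and $\mathrm{Aut}(G)$ permutes the indices according to the permutation of the vertices of $G$. A minor of $G$ is a graph obtained from $G$ by a sequence of edge contractions and vertex deletions (no edge deletions; multiple edges are merged). Thus each vertex of $G$ is either deleted or has an image vertex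 in $H$. For a graph $H$, the $3$-coloring graph $C_3(H)$ has as vertices the proper $3$-colorings of $H$ with colors $\{1,2,3\}$; two colorings are joined by an edge if one can be obtained from the other by picking a color $i\in\{1,2,3\}$, picking a connected component of the induced subgraph on all vertices with colors not equal to $i$, and switching the other two colors on this component. $H$ is $3$-rigid if $C_3(H)$ is disconnected. *)

(* Defs.v *)
From HB Require Import structures.
From mathcomp Require Import all_boot all_fingroup all_algebra.
From mathcomp Require Import mpoly.

Set Implicit Arguments.
Unset Strict Implicit.
Unset Printing Implicit Defensive.

Import GRing.Theory.
Local Open Scope ring_scope.

Record sgraph := SGraph {
  vertex :> finType;
  adj : rel vertex;
  adj_sym : ssrbool.symmetric adj;
  adj_irr : irreflexive adj
}.
Arguments adj {s}.

(** * Minors *)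

Section MinorOperations.
Variable H : sgraph.

Section Deletion.
Variable v : H.

Definition delete_adj : rel {x : H | x != v} :=
  fun x y => adj (val x) (val y).

Lemma delete_adj_sym : ssrbool.symmetric delete_adj.
Proof. by move=> x y; rewrite /delete_adj adj_sym. Qed.

Lemma delete_adj_irr : irreflexive delete_adj.
Proof. by move=> x; rewrite /delete_adj adj_irr. Qed.

Definition delete : sgraph := SGraph delete_adj_sym delete_adj_irr.

Definition delete_map (x : H) : option delete := insub x.

End Deletion.

(* The vertex resulting from the contraction of the edge {u, v} is called u. *)
Section Contraction.
Variables u v : H.

Definition contract_adj : rel {x : H | x != v} := fun x y =>
  (x != y) &&
  [|| adj (val x) (val y),
      (val x == u) && adj v (val y) |
      (val y == u) && adj (val x) v].

Lemma contract_adj_sym : ssrbool.symmetric contract_adj.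
Proof.
move=> x y; rewrite /contract_adj [y == x]eq_sym; congr (_ && _).
rewrite [adj (val y) (val x)]adj_sym [adj v (val x)]adj_sym.
by rewrite [adj (val y) v]adj_sym; congr (_ || _); rewrite orbC.
Qed.

Lemma contract_adj_irr : irreflexive contract_adj.
Proof. by move=> x; rewrite /contract_adj eqxx. Qed.

Definition contract : sgraph := SGraph contract_adj_sym contract_adj_irr.

(* When u and v are adjacent, u != v and hence insub yields Some. *)
Definition contract_map (x : H) : option contract :=
  insub (if x == v then u else x).

End Contraction.
End MinorOperations.

(* A term of type [minor_way pi] is a sequence of vertex deletions and edge
   contractions turning G into H; pi sends a vertex of G to its image in H, or
   to None if that vertex is deleted. *)
Inductive minor_way (G : sgraph) : forall H : sgraph, (G -> option H) -> Type :=
| MinorSelf : @minor_way G G Some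
| MinorDelete (H : sgraph) (pi : G -> option H) (v : H) :
    minor_way pi ->
    @minor_way G (delete v) (fun k => obind (@delete_map H v) (pi k))
| MinorContract (H : sgraph) (pi : G -> option H) (u v : H) :
    adj u v -> minor_way pi ->
    @minor_way G (contract u v) (fun k => obind (@contract_map H u v) (pi k)).

(** * The 3-coloring graph *)

Definition proper (H : sgraph) (c : {ffun H -> 'I_3}) : bool :=
  [forall x, forall y, adj x y ==> (c x != c y)].

Definition coloring (H : sgraph) : finType :=
  {c : {ffun H -> 'I_3} | proper c}.

(* Adjacency in the subgraph of H induced on the vertices not colored i. *)
Definition avoid_adj (H : sgraph) (c : {ffun H -> 'I_3}) (i : 'I_3) : rel H :=
  fun x y => [&& c x != i, c y != i & adj x y].

(* c' arises from c by switching the two colors j, k other than i on the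
   component containing x of the subgraph induced on the vertices not
   colored i. *)
Definition C3 (H : sgraph) : rel (coloring H) := fun c c' =>
  [exists i : 'I_3, exists j : 'I_3, exists k : 'I_3, exists x : H,
    [&& uniq [:: i; j; k], val c x != i &
      [forall y, val c' y ==
         if connect (avoid_adj (val c) i) x y then tperm j k (val c y)
         else val c y]]].

Definition three_rigid (H : sgraph) : Prop :=
  exists c c' : coloring H, ~~ connect (@C3 H) c c'.

(* s contains exactly one coloring from each connected component of C_3(H). *)
Definition component_representatives (H : sgraph) (s : seq (coloring H)) :=
  forall c : coloring H, count (connect (@C3 H) c) s = 1%N.

(** * Polynomial rings with variables indexed by a finite type *)

Section Polynomials.
Variable K : fieldType.

Definition var (I : finType) (i : I) : {mpoly K[#|I|]} := 'X_(enum_rank i).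

Definition subst (I J : finType) (h : I -> {mpoly K[#|J|]}) :
    {mpoly K[#|I|]} -> {mpoly K[#|J|]} :=
  mmap (@mpolyC #|J| K) (fun i => h (enum_val i)).

Definition generated_ideal (A : comNzRingType) (S : A -> Prop) (g : A) : Prop :=
  exists s : seq (A * A),
    (forall x, x \in s -> S x.2) /\ g = \sum_(x <- s) x.1 * x.2.

Definition homogeneous_binomial (k d : nat) (f : {mpoly K[k]}) : Prop :=
  exists m1 m2 : 'X_{1..k},
    [/\ mdeg m1 = d, mdeg m2 = d, m1 != m2 & f = 'X_[m1] - 'X_[m2]].

(** * The ideal of a graph on [n] *)

Section GraphIdeal.
Variables (n : nat) (e : rel 'I_n).

Definition state : finType := {ffun 'I_n -> bool}.

Definition isolated (l : 'I_n) : bool := [forall k, ~~ e l k].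

(* Each edge {j, k} is represented by its ordered pair with j < k. *)
Definition edge : finType :=
  {jk : 'I_n * 'I_n | (jk.1 < jk.2)%N && e jk.1 jk.2}.

Definition isolated_vertex : finType := {l : 'I_n | isolated l}.

(* inl ((j, k), (a, b)) indexes t^(j,k)_(a,b), and inr (l, a) indexes
   t^(l)_a. *)
Definition parameter : finType :=
  ((edge * (bool * bool)) + (isolated_vertex * bool))%type.

Definition phi : {mpoly K[#|state|]} -> {mpoly K[#|parameter|]} :=
  subst (fun w : state =>
    (\prod_(E : edge)
        var (inl (E, (w (val E).1, w (val E).2)) : parameter)) *
    \prod_(l : isolated_vertex) var (inr (l, w (val l)) : parameter)).

Definition graph_ideal (f : {mpoly K[#|state|]}) : Prop := phi f = 0.

(* [msize g] is the degree of g plus one when g != 0, and [msize 0 = 0]. *)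
Definition minimal_generator (d : nat) (f : {mpoly K[#|state|]}) : Prop :=
  [/\ homogeneous_binomial d f, graph_ideal f &
      ~ generated_ideal (fun g => graph_ideal g /\ (msize g <= d)%N) f].

Definition graph_aut (s : 'S_n) : Prop := forall j k, e (s j) (s k) = e j k.

(* The action of (Z/2)^n x| Aut(G): the index at position k is moved to
   position s k, and then c is added in Z/2 = (bool, addb). *)
Definition act_state (c : {ffun 'I_n -> bool}) (s : 'S_n) (w : state) : state :=
  [ffun r => w ((s^-1)%g r) (+) c r].

Definition equivalent (f g : {mpoly K[#|state|]}) : Prop :=
  exists (c : {ffun 'I_n -> bool}) (s : 'S_n),
    graph_aut s /\ g = subst (fun w => var (act_state c s w)) f.

Definition quadratic_binomial_in_ideal (f : {mpoly K[#|state|]}) : Prop :=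
  homogeneous_binomial 2 f /\ graph_ideal f.

Section Tableaux.
Variables (H : sgraph) (pi : 'I_n -> option H).

Definition tableau_row (R : coloring H) (j : 'I_3) : state :=
  [ffun k => if pi k is Some x then val R x == j else true].

Definition tableau_binomial (R1 R : coloring H) : {mpoly K[#|state|]} :=
  \prod_(j < 3) var (tableau_row R1 j) - \prod_(j < 3) var (tableau_row R j).

End Tableaux.

End GraphIdeal.

(* The elements f obtained from the 3-rigid minors of the graph with adjacency
   relation e, where [rep w] lists the chosen representatives R_1, R_2, ... for
   the minor obtained by w. *)
Definition rigid_minor_element (n : nat) (e : rel 'I_n)
    (e_sym : ssrbool.symmetric e) (e_irr : irreflexive e)
    (rep : forall (H : sgraph) (pi : SGraph e_sym e_irr -> option H),
        minor_way pi -> seq (coloring H))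
    (f : {mpoly K[#|state n|]}) : Prop :=
  exists (H : sgraph) (pi : SGraph e_sym e_irr -> option H) (w : minor_way pi)
         (R1 R : coloring H) (Rs : seq (coloring H)),
    [/\ three_rigid H, rep H pi w = R1 :: Rs, R \in Rs &
        f = tableau_binomial pi R1 R].

End Polynomials.

(* Main.v *)
Require Import Defs.
From HB Require Import structures.
From mathcomp Require Import all_boot all_fingroup all_algebra.
From mathcomp Require Import complex reals.
From mathcomp Require Import mpoly zify.

Set Implicit Arguments.
Unset Strict Implicit.
Unset Printing Implicit Defensive.

Import GRing.Theory.
Local Open Scope ring_scope.

(** The toric ideal of G is spanned by differences of monomials with the same
    image, so everything reduces to the fibres of the monomial map. A monomial
    of degree d is a multiset of d states, that is, a tableau with d rows, and
    two tableaux lie in the same fibre exactly when they have the same margins: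
    the same counts of values at every vertex and of pairs of values along
    every edge.

    A fibre of degree 3 is a set of colorings. Every column of a tableau with
    three rows has an odd number of ones after flipping suitable vertices, and
    flips preserve margins and equivalence of generators. A column with three ones is
    constant on the fibre; its vertex is deleted. A column with a single one is
    a color, namely the row of that one. The margins along an edge say
    precisely whether its ends have equal colors; contracting the edges with
    equal ends gives a minor H, and the tableaux of the fibre are the proper
    3-colorings of H up to permuting the colors ([minor_coloring_exists],
    [lift_coloring]).

    A quadratic move keeps one row i of the tableau, that is, one color class,
    and conversely two colorings that share the color class i differ by
    switching the two other colors on some Kempe components
    ([shared_class_connect]). A transposition of colors also keeps a class. So
    the classes of a degree-3 fibre modulo quadratic moves are the connected
    components of C_3(H).

    For minimality ([tableau_binomial_minimal]), the indicator of the tableaux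
    of one component extends to a linear functional. It kills all multiples of
    elements of degree at most 2 of the ideal, because these move inside
    components, but it is 1 on the binomial of two colorings in different
    components. For generation ([colorings_linked], [linked_generate]), a
    component is crossed by quadratic moves, and one passes from one component
    to another through the representative R_1. *)

(** * Monomials as words *)

Section Words.
Variable I : finType.
Implicit Types (s t : seq I) (m : 'X_{1..#|I|}).

Definition monomial s : 'X_{1..#|I|} := (\sum_(x <- s) U_(enum_rank x))%MM.

Definition word m : seq I :=
  flatten [seq nseq (m (enum_rank x)) x | x <- enum I].

Lemma monomial_cat s t : monomial (s ++ t) = (monomial s + monomial t)%MM.
Proof. exact: big_cat. Qed.

Lemma monomial_count s x : monomial s (enum_rank x) = count_mem x s.
Proof.
rewrite mnm_sumE -sum1_count [RHS]big_mkcond; apply: eq_bigr => y _.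
by rewrite mnm1E (inj_eq enum_rank_inj) /=; case: (y == x).
Qed.

Lemma mdeg_monomial s : mdeg (monomial s) = size s.
Proof.
rewrite mdeg_sum -sum1_size; apply: eq_bigr => x _; exact: mdeg1.
Qed.

Lemma eq_monomial s t : (monomial s == monomial t) = perm_eq s t.
Proof.
apply/eqP/idP => [st | /seq.permP st].
  by apply/allP => x _; rewrite /= -!monomial_count st.
by apply/mnmP => i; rewrite -(enum_valK i) !monomial_count; apply: st.
Qed.

Lemma wordK m : monomial (word m) = m.
Proof.
apply/mnmP => i; rewrite -(enum_valK i) monomial_count count_flatten -map_comp.
rewrite sumnE big_map big_enum /= (bigD1 (enum_val i)) //= count_nseq /= eqxx mul1n.
rewrite big1 ?addn0 // => x neq; rewrite count_nseq /=.
by rewrite (negbTE neq) mul0n.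
Qed.

Lemma size_word m : size (word m) = mdeg m.
Proof. by rewrite -mdeg_monomial wordK. Qed.

Lemma monomialX (K : fieldType) s :
  'X_[monomial s] = \prod_(x <- s) var K x.
Proof. by rewrite /var mprodXE. Qed.

End Words.

Lemma substX (K : fieldType) (I J : finType) (h : I -> {mpoly K[#|J|]})
    (s : seq I) :
  subst h 'X_[monomial s] = \prod_(x <- s) h x.
Proof.
rewrite monomialX /subst rmorph_prod /=; apply: eq_bigr => x _.
by rewrite /var mmapX mmap1U enum_rankK.
Qed.

Lemma substB (K : fieldType) (I J : finType) (h : I -> {mpoly K[#|J|]}) f g :
  subst h (f - g) = subst h f - subst h g.
Proof. exact: mmapB. Qed.

(** If h sends monomials to monomials, the coefficients of an element of its
    kernel sum to zero over each fibre of the monomial map p; weighting the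
    fibres by any vector-valued F packages these relations in one identity. *)
Lemma subst_sum_eq0 (K : fieldType) (I J : finType) (h : I -> {mpoly K[#|J|]})
    (p : 'X_{1..#|I|} -> 'X_{1..#|J|}) (V : lmodType K) (F : 'X_{1..#|J|} -> V)
    (g : {mpoly K[#|I|]}) :
  (forall m, subst h 'X_[m] = 'X_[p m]) -> subst h g = 0 ->
  \sum_(m <- msupp g) g@_m *: F (p m) = 0.
Proof.
move=> hX g0.
have coef0 t : \sum_(m <- msupp g | p m == t) g@_m = 0.
  have := congr1 (mcoeff t) g0.
  rewrite /subst /mmap raddf_sum mcoeff0 => sum0.
  rewrite -[RHS]sum0 [LHS]big_mkcond; apply: eq_bigr => m _ /=.
  rewrite -(mmapX _ (@mpolyC #|J| K)) [mmap _ _ _]hX mul_mpolyC mcoeffZ mcoeffX.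
  by case: (p m == t); rewrite ?mulr1 ?mulr0.
pose T := undup (map p (msupp g)).
transitivity (\sum_(m <- msupp g) \sum_(t <- T) (g@_m * (p m == t)%:R) *: F t).
  apply: eq_big_seq => m m_g; rewrite (bigD1_seq (p m)) ?undup_uniq //=; last first.
    by rewrite mem_undup map_f.
  rewrite eqxx mulr1 big1 ?addr0 // => t neq.
  by rewrite eq_sym (negbTE neq) mulr0 scale0r.
rewrite exchange_big big1 //= => t _; rewrite -scaler_suml.
rewrite -[X in X *: _](_ : 0 = _) ?scale0r //.
rewrite -[LHS](coef0 t) big_mkcond; apply: eq_bigr => m _.
by case: (p m == t); rewrite ?mulr1 ?mulr0.
Qed.

(** * Ideals given by generators *)

Section Ideal.
Variables (A : comNzRingType) (S : A -> Prop).
Notation J := (generated_ideal S).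

Lemma ideal_gen x : S x -> J x.
Proof.
move=> Sx; exists [:: (1, x)]; split; first by move=> y /[!inE] /eqP->.
by rewrite big_seq1 mul1r.
Qed.

Lemma ideal0 : J 0.
Proof. by exists [::]; split=> //; rewrite big_nil. Qed.

Lemma idealD x y : J x -> J y -> J (x + y).
Proof.
move=> [s [sS ->]] [t [tS ->]]; exists (s ++ t); rewrite big_cat; split=> // z.
by rewrite mem_cat => /orP[/sS | /tS].
Qed.

Lemma idealM a x : J x -> J (a * x).
Proof.
move=> [s [sS ->]]; exists [seq (a * z.1, z.2) | z <- s]; split.
  by move=> _ /mapP[z zs ->]; apply: sS z zs.
by rewrite big_map mulr_sumr; apply: eq_bigr => z _; rewrite mulrA.
Qed.

Lemma idealN x : J x -> J (- x).
Proof. by rewrite -mulN1r; apply: idealM. Qed.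

Lemma ideal_sum (T : eqType) (s : seq T) (F : T -> A) :
  (forall x, x \in s -> J (F x)) -> J (\sum_(x <- s) F x).
Proof.
move=> JF; rewrite big_seq.
by apply: big_ind => //; [exact: ideal0 | exact: idealD].
Qed.

End Ideal.

(** * Fibres of the parametrization *)

Lemma count_graph (T : finType) (U : eqType) (h : T -> U) x u :
  count_mem (x, u) [seq (y, h y) | y <- enum T] = (h x == u).
Proof.
rewrite enumT count_map.
rewrite (@eq_count _ _ (fun y => (y == x) && (h x == u))) => [|y]; last first.
  by rewrite /= xpair_eqE; case: eqP => // ->.
case: (h x == u); last first.
  by rewrite (@eq_count _ _ pred0) ?count_pred0 // => y; rewrite andbF.
rewrite (@eq_count _ _ (pred1 x)) => [|y]; last by rewrite andbT.
exact: enumP.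
Qed.

Lemma count_inl (T U : eqType) (s : seq T) (t : seq U) x :
  count_mem (inl x) (map inl s ++ map inr t) = count_mem x s.
Proof.
rewrite count_cat !count_map addnC (@eq_count _ _ pred0) // count_pred0.
exact: eq_count.
Qed.

Lemma count_inr (T U : eqType) (s : seq T) (t : seq U) y :
  count_mem (inr y) (map inl s ++ map inr t) = count_mem y t.
Proof.
rewrite count_cat !count_map (@eq_count _ _ pred0) // count_pred0.
exact: eq_count.
Qed.

Section Fibers.
Variables (n : nat) (e : rel 'I_n).
Hypotheses (e_sym : ssrbool.symmetric e) (e_irr : irreflexive e).
Implicit Types (s t : seq (state n)) (w : state n).

Definition parameters w : seq (parameter e) :=
  map inl [seq (E, (w (val E).1, w (val E).2)) | E <- enum (edge e)] ++
  map inr [seq (l, w (val l)) | l <- enum (isolated_vertex e)].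

Definition image_word s := flatten [seq parameters w | w <- s].

Definition same_margins s t :=
  (forall k l x y, e k l ->
     count (fun w => (w k == x) && (w l == y)) s =
     count (fun w => (w k == x) && (w l == y)) t) /\
  (forall k x, count (fun w => w k == x) s = count (fun w => w k == x) t).

Lemma phi_monomial (K : fieldType) s :
  @phi K n e 'X_[monomial s] = 'X_[monomial (image_word s)].
Proof.
rewrite /phi substX; elim: s => [|w s IH].
  by rewrite !big_nil -mpolyX0 /monomial big_nil.
rewrite big_cons IH /image_word /= -/(image_word s) monomial_cat mpolyXD.
congr (_ * _); rewrite monomialX big_cat !big_map.
by congr (_ * _); rewrite big_enum.
Qed.

Lemma count_image (P : pred (parameter e)) s :
  count P (image_word s) = sumn [seq count P (parameters w) | w <- s].
Proof. by rewrite count_flatten -map_comp. Qed.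

Lemma count_edge_parameter s (E : edge e) x y :
  count_mem (inl (E, (x, y))) (image_word s) =
  count (fun w => (w (val E).1 == x) && (w (val E).2 == y)) s.
Proof.
rewrite count_image; elim: s => //= w s ->; congr (_ + _)%N.
by rewrite count_inl count_graph.
Qed.

Lemma count_isolated_parameter s (l : isolated_vertex e) x :
  count_mem (inr (l, x)) (image_word s) = count (fun w => w (val l) == x) s.
Proof.
rewrite count_image; elim: s => //= w s ->; congr (_ + _)%N.
by rewrite count_inr count_graph.
Qed.

Lemma count_bool_split (P Q : pred (state n)) s :
  count P s = (count (fun w => P w && (Q w == true)) s +
               count (fun w => P w && (Q w == false)) s)%N.
Proof. by elim: s => //= w s ->; case: (P w) (Q w) => [] [] /=; lia. Qed.

(** Each parameter is a margin of an edge in its increasing orientation or of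
    an isolated vertex; the margin of a vertex that is not isolated is
    recovered by summing those of an edge through it. *)
Lemma same_marginsP s t :
  reflect (same_margins s t) (perm_eq (image_word s) (image_word t)).
Proof.
have edgeP k l x y : e k l -> exists p : parameter e, forall s',
    count (fun w => (w k == x) && (w l == y)) s' = count_mem p (image_word s').
  case: (ltngtP k l) => [kl ekl | lk ekl | /val_inj-> ]; last by rewrite e_irr.
    have E1 : ((k, l).1 < (k, l).2)%N && e (k, l).1 (k, l).2 by rewrite kl.
    by exists (inl (exist _ (k, l) E1, (x, y))) => s'; rewrite count_edge_parameter.
  have E1 : ((l, k).1 < (l, k).2)%N && e (l, k).1 (l, k).2 by rewrite lk /= e_sym.
  exists (inl (exist _ (l, k) E1, (y, x))) => s'; rewrite count_edge_parameter.
  by apply: eq_count => w; rewrite andbC.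
apply: (iffP idP) => [/seq.permP st | [st_e st_v]].
  have st_e k l x y : e k l ->
     count (fun w => (w k == x) && (w l == y)) s =
     count (fun w => (w k == x) && (w l == y)) t.
    by move=> /(edgeP k l x y)[p pP]; rewrite !pP.
  split=> // k x; case isol_k: (isolated e k).
    have := st (pred1 (inr (exist _ k isol_k, x))).
    by rewrite !count_isolated_parameter.
  move/negbT: isol_k; rewrite negb_forall => /existsP[l]; rewrite negbK => ekl.
  rewrite [LHS](count_bool_split _ (fun w => w l)).
  by rewrite [RHS](count_bool_split _ (fun w => w l)) !st_e.
apply/allP => -[[E [x y]] | [l x]] _ /=.
  by rewrite !count_edge_parameter st_e //; have /andP[] := valP E.
by rewrite !count_isolated_parameter st_v.
Qed.

(** A vertex is needed: without vertices the only state maps to 1, and fibres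
    mix degrees. *)
Lemma same_margins_size s t : (0 < n)%N -> same_margins s t -> size s = size t.
Proof.
move=> n_gt0 [_ sv]; pose k := Ordinal n_gt0.
have sz u : size u = (count (fun w : state n => w k == true) u +
                      count (fun w => w k == false) u)%N.
  by rewrite -(count_predT u) (count_bool_split predT (fun w => w k)).
by rewrite !sz !sv.
Qed.

End Fibers.

Section Flips.
Variables (n : nat) (e : rel 'I_n).
Implicit Types (s t u : seq (state n)) (w : state n).

Lemma same_margins_trans s t u :
  same_margins e s t -> same_margins e t u -> same_margins e s u.
Proof.
move=> [st_e st_v] [tu_e tu_v]; split=> [k l x y ekl | k x].
  by rewrite st_e ?tu_e.
by rewrite st_v.
Qed.

Lemma perm_same_margins s t : perm_eq s t -> same_margins e s t.
Proof. by move=> /seq.permP st; split=> *; apply: st. Qed.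

Lemma same_margins_cat s t u :
  same_margins e (u ++ s) (u ++ t) <-> same_margins e s t.
Proof.
split=> -[st_e st_v]; split=> [k l x y ekl | k x].
- by have := st_e k l x y ekl; rewrite !count_cat => /addnI.
- by have := st_v k x; rewrite !count_cat => /addnI.
- by rewrite !count_cat st_e.
- by rewrite !count_cat st_v.
Qed.

Definition flip (c : {ffun 'I_n -> bool}) : state n -> state n :=
  act_state c 1%g.

Lemma flipE c w k : flip c w k = w k (+) c k.
Proof. by rewrite ffunE invg1 perm1. Qed.

Lemma flipK c : involutive (flip c).
Proof. by move=> w; apply/ffunP => k; rewrite !flipE addbK. Qed.

Lemma same_margins_flip c s t :
  same_margins e s t -> same_margins e (map (flip c) s) (map (flip c) t).
Proof.
have flip_eq w k x : (flip c w k == x) = (w k == x (+) c k).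
  by rewrite flipE; case: (w k) x (c k) => [] [] [].
move=> [st_e st_v]; split=> [k l x y ekl | k x]; rewrite !count_map.
  rewrite -(eq_count (a1 := fun w => (w k == x (+) c k) && (w l == y (+) c l))).
    by rewrite st_e //; apply: eq_count => w /=; rewrite !flip_eq.
  by move=> w /=; rewrite !flip_eq.
rewrite -(eq_count (a1 := fun w => w k == x (+) c k)).
  by rewrite st_v //; apply: eq_count => w /=; rewrite !flip_eq.
by move=> w /=; rewrite !flip_eq.
Qed.

End Flips.

(** * Moves between words modulo an ideal *)

Section Links.
Variables (K : fieldType) (I : finType) (S : {mpoly K[#|I|]} -> Prop).
Implicit Types (s t u : seq I).

Definition linked s t : Prop :=
  generated_ideal S ('X_[monomial s] - 'X_[monomial t]).

Lemma perm_linked s t : perm_eq s t -> linked s t.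
Proof. by rewrite -eq_monomial /linked => /eqP->; rewrite subrr; apply: ideal0. Qed.

Lemma linked_sym s t : linked s t -> linked t s.
Proof. by move=> /idealN; rewrite opprB. Qed.

Lemma linked_trans s t u : linked s t -> linked t u -> linked s u.
Proof. by move=> st tu; have := idealD st tu; rewrite addrA subrK. Qed.

Lemma linked_cat u s t : linked s t -> linked (u ++ s) (u ++ t).
Proof.
by move=> /(idealM 'X_[monomial u]); rewrite mulrBr -!mpolyXD -!monomial_cat.
Qed.

End Links.

Section GraphIdeal.
Variables (K : fieldType) (n : nat) (e : rel 'I_n).
Hypotheses (n_gt0 : (0 < n)%N).
Hypotheses (e_sym : ssrbool.symmetric e) (e_irr : irreflexive e).
Implicit Types (s t : seq (state n)).

Lemma graph_ideal_binomial s t :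
  graph_ideal e ('X_[K, monomial s] - 'X_[monomial t]) <-> same_margins e s t.
Proof.
have -> : graph_ideal e ('X_[K, monomial s] - 'X_[monomial t]) <->
    'X_[K, monomial (image_word e s)] - 'X_[monomial (image_word e t)] = 0.
  by rewrite /graph_ideal -!phi_monomial -substB.
split=> [/eqP | /same_marginsP]; last first.
  by rewrite -eq_monomial // => /(_ e_sym e_irr)/eqP->; rewrite subrr.
move=> /eqP/subr0_eq/(congr1 (mcoeff (monomial (image_word e t)))).
rewrite !mcoeffX eqxx; case: eqP => [/eqP | _ /esym/eqP]; last by rewrite oner_eq0.
by rewrite eq_monomial => /same_marginsP st _; apply: st.
Qed.

Definition fiber (m : 'X_{1..#|state n|}) : 'X_{1..#|parameter e|} :=
  monomial (image_word e (word m)).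

Lemma phiX m : phi e 'X_[K, m] = 'X_[fiber m].
Proof. by rewrite -{1}(wordK m) phi_monomial. Qed.

Lemma fiber_eqP m m' :
  reflect (same_margins e (word m) (word m')) (fiber m == fiber m').
Proof. by rewrite eq_monomial; apply: same_marginsP. Qed.

Lemma fiber_sum_eq0 (V : lmodType K) (F : 'X_{1..#|parameter e|} -> V) g :
  graph_ideal e g -> \sum_(m <- msupp g) g@_m *: F (fiber m) = 0.
Proof. exact: (subst_sum_eq0 F phiX). Qed.

(** An element of the kernel is a combination of differences of monomials in
    the same fibre: subtract from each monomial a representative of its fibre,
    after which the coefficients of every representative add up to zero. *)
Lemma linked_generate (S : {mpoly K[#|state n|]} -> Prop) (d : nat) g :
  (forall s t, (size s <= d)%N -> same_margins e s t -> linked S s t) ->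
  graph_ideal e g -> (msize g <= d.+1)%N -> generated_ideal S g.
Proof.
move=> S_link g_in g_size.
pose rho T := nth 0%MM (msupp g) (find (fun m => fiber m == T) (msupp g)).
have rhoP m : m \in msupp g -> fiber (rho (fiber m)) = fiber m.
  move=> m_g; apply/eqP; apply: (nth_find 0%MM (a := fun m' => fiber m' == fiber m)).
  by apply/hasP; exists m.
have := fiber_sum_eq0 (fun T => 'X_[rho T]) g_in => /= sum0.
have -> : g = \sum_(m <- msupp g) (g@_m)%:MP * ('X_[m] - 'X_[rho (fiber m)]).
  rewrite {1}[g]mpolyE -[LHS]subr0 -[X in _ - X]sum0 -sumrB.
  by apply: eq_bigr => m _; rewrite mul_mpolyC scalerBr.
apply: ideal_sum => m m_g; apply: idealM.
rewrite -[m in 'X_[m]]wordK -[rho _]wordK; apply: S_link.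
  by rewrite size_word -ltnS (leq_trans _ g_size) // msize_mdeg_lt.
by apply/fiber_eqP; rewrite eq_sym rhoP.
Qed.

Lemma fiber_mdeg m m' : fiber m = fiber m' -> mdeg m = mdeg m'.
Proof.
by move=> /eqP/fiber_eqP; rewrite -!size_word; apply: same_margins_size.
Qed.

(** The sum of the coefficients over a set chi of monomials is linear in f. If
    membership in chi of the monomial m + v depends only on m and on the fibre
    of v, then on a multiple of g this sum is a combination of the fibre sums
    of g, which vanish. The bound D makes the sum range over a fixed finite
    type, so that linearity is immediate. *)
Lemma stable_coefficient_sum_eq0 (d : nat) (chi : pred 'X_{1..#|state n|}) (D : nat) f :
  (forall m, chi m -> mdeg m = D) ->
  (forall m u v, fiber u = fiber v -> (mdeg u <= d)%N ->
     chi (m + u)%MM -> chi (m + v)%MM) ->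
  generated_ideal (fun g => graph_ideal e g /\ (msize g <= d.+1)%N) f ->
  \sum_(m : 'X_{1..#|state n| < D.+1}) f@_m * (chi m)%:R = 0 :> K.
Proof.
move=> chi_deg chi_inv [s [sS ->]].
pose L (h : {mpoly K[#|state n|]}) :=
  \sum_(m : 'X_{1..#|state n| < D.+1}) h@_m * (chi m)%:R.
have LD (T : Type) (r : seq T) (F : T -> {mpoly K[#|state n|]}) :
    L (\sum_(i <- r) F i) = \sum_(i <- r) L (F i).
  rewrite /L [RHS]exchange_big /=; apply: eq_bigr => m _.
  by rewrite raddf_sum mulr_suml.
have LZ c h : L (c *: h) = c * L h.
  by rewrite /L mulr_sumr; apply: eq_bigr => m _; rewrite mcoeffZ mulrA.
have LX m : L 'X_[m] = (chi m)%:R.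
  rewrite /L; case chi_m: (chi m); last first.
    rewrite big1 // => m' _; rewrite mcoeffX; case: eqP => [<- | _].
      by rewrite chi_m mulr0.
    by rewrite mul0r.
  have m_lt : (mdeg m < D.+1)%N by rewrite (chi_deg _ chi_m).
  rewrite (bigD1 (BMultinom m_lt)) //= mcoeffX eqxx chi_m mul1r.
  rewrite big1 ?addr0 // => m' neq.
  rewrite mcoeffX; case: eqP => [mm' | _]; last by rewrite mul0r.
  by case/eqP: neq; apply: val_inj.
transitivity (L (\sum_(x <- s) x.1 * x.2)); first by [].
clearbody L; rewrite LD big_seq big1 // => -[a g] /sS[/= g_in g_size].
rewrite [a]mpolyE mulr_suml LD big1 // => m _; rewrite -scalerAl LZ.
rewrite [g]mpolyE mulr_sumr LD.
(* By stability of chi, testing one v of the fibre T amounts to testing all. *)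
pose F T : K^o := [exists v : 'X_{1..#|state n| < d.+1},
  (fiber v == T) && chi (m + v)%MM]%:R.
rewrite -[X in _ * X](_ : 0 = _) ?mulr0 // -[LHS](fiber_sum_eq0 F g_in).
rewrite big_seq [RHS]big_seq; apply: eq_bigr => v v_g.
have v_lt : (mdeg v < d.+1)%N by rewrite (leq_trans _ g_size) // msize_mdeg_lt.
rewrite -scalerAr LZ -mpolyXD LX /F; congr (_ * (_ : bool)%:R).
apply/existsP/idP => [[u /andP[/eqP uv]] | chi_v].
  by apply: chi_inv; last by rewrite -ltnS bmdeg.
by exists (BMultinom v_lt); rewrite eqxx.
Qed.

End GraphIdeal.

(** * Connectedness of the 3-coloring graph *)

Ltac color_cases :=
  repeat match goal with |- forall _ : ordinal 3, _ => case=> [[|[|[|?]]] ?] // end.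

Lemma two_of_three (i a b a' b' : 'I_3) :
  [&& a != b, a' != b', (a == i) == (a' == i), (b == i) == (b' == i),
      a != i, b != i & a != a'] ==> (b != b').
Proof. by move: i a b a' b'; color_cases. Qed.

Lemma third_color (i j : 'I_3) : i != j -> exists k, uniq [:: k; i; j].
Proof.
move=> ij; suff: has (fun k => uniq [:: k; i; j]) [:: 0; 1; 2 : 'I_3].
  by move=> /hasP[k _ kij]; exists k.
by move: i j ij; color_cases.
Qed.

Section Colorings.
Variable H : sgraph.
Implicit Types (c : {ffun H -> 'I_3}) (R : coloring H) (x y : H) (i j k : 'I_3).

Lemma properP c : reflect (forall x y, adj x y -> c x != c y) (Defs.proper c).
Proof.
apply: (iffP forallP) => [pc x y | pc x]; first by move/implyP: (forallP (pc x) y).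
by apply/forallP => y; apply/implyP/pc.
Qed.

Lemma tperm_avoids i j k (a : 'I_3) : uniq [:: i; j; k] -> (tperm j k a == i) = (a == i).
Proof. 
rewrite permE /=; suff /implyP h : uniq [:: i; j; k] ==>
  (((if a == j then k else if a == k then j else a) == i) == (a == i)).
  by move=> /h/eqP.
by move: i j k a; color_cases.
Qed.

(** Off the class i both colorings use the same two colors, so along an edge
    avoiding the class i they either agree at both ends or differ at both. *)
Lemma kempe_component R R' i x :
  (forall y, (val R y == i) = (val R' y == i)) -> val R x != val R' x ->
  forall y, connect (avoid_adj (val R) i) x y ->
    val R y != i /\ val R y != val R' y.
Proof.
move=> RR' Rx y /connectP[p + ->].
have: val R x != i /\ val R x != val R' x.
  split=> //; apply: contraNneq Rx => Rxi.
  by move: (RR' x); rewrite Rxi eqxx => /esym/eqP->.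
elim: p x {Rx} => //= z p IH x [Rxi Rx] /andP[/and3P[_ Rzi xz]]; apply: IH; split=> //.
have /properP/(_ _ _ xz) := valP R; have /properP/(_ _ _ xz) := valP R'.
move=> R'xz Rxz.
have /implyP := two_of_three i (val R x) (val R z) (val R' x) (val R' z); apply.
by rewrite Rxz R'xz !RR' !eqxx -!RR' Rxi Rzi Rx.
Qed.

(** By induction on the number of vertices where the colorings differ: switching
    the Kempe component of such a vertex makes R agree with R' on the whole
    component and leaves the other vertices untouched. *)
Lemma shared_class_connect R R' i :
  (forall x, (val R x == i) = (val R' x == i)) -> connect (@C3 H) R R'.
Proof.
have [m] := ubnP #|[set x | val R x != val R' x]|; elim: m R => // m IH R diff_lt RR'.
have [x Rx | same] := pickP (fun x => val R x != val R' x); last first.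
  suff -> : R = R' by [].
  by apply/val_inj/ffunP => x; have /negbFE/eqP := same x.
pose j := val R x; pose k := val R' x.
have comp := kempe_component RR' Rx.
have [Rxi _] := comp x (connect0 _ _).
have R'xi : val R' x != i by rewrite -RR'.
have ijk : uniq [:: i; j; k].
  by rewrite /= !inE negb_or ![i == _]eq_sym Rxi R'xi Rx.
pose C := connect (avoid_adj (val R) i) x.
pose c1 : {ffun H -> 'I_3} :=
  [ffun y => if C y then tperm j k (val R y) else val R y].
have c1_class y : (c1 y == i) = (val R y == i).
  by rewrite ffunE; case: (C y) => //; rewrite tperm_avoids.
have c1_proper : Defs.proper c1.
  have stay y z : adj y z -> C y -> ~~ C z -> c1 y != c1 z.
    move=> yz Cy nCz; have [Ryi _] := comp y Cy.
    have /eqP Rzi : val R z == i.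
      apply: contraNT nCz => Rzi; apply: connect_trans Cy (connect1 _).
      by rewrite /avoid_adj Ryi Rzi.
    have /eqP -> : c1 z == i by rewrite c1_class Rzi.
    by rewrite c1_class.
  apply/properP => y z yz; case Cy: (C y); case Cz: (C z).
  - by rewrite !ffunE Cy Cz (inj_eq perm_inj); move: yz; apply/properP/(valP R).
  - by apply: stay => //; rewrite Cz.
  - by rewrite eq_sym; apply: stay; rewrite ?Cy // adj_sym.
  - by rewrite !ffunE Cy Cz; move: yz; apply/properP/(valP R).
pose R1 : coloring H := exist _ c1 c1_proper.
have C3R1 : C3 R R1.
  apply/existsP; exists i; apply/existsP; exists j; apply/existsP; exists k.
  apply/existsP; exists x; apply/and3P; split=> //.
  by apply/forallP => y; rewrite ffunE.
apply: connect_trans (connect1 C3R1) _; apply: IH => [|y]; last by rewrite -RR' c1_class.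
rewrite -ltnS; apply: leq_trans diff_lt; rewrite ltnS; apply: proper_card.
apply/fintype.properP; split.
  apply/subsetP => y; rewrite !inE ffunE; case Cy: (C y) => //.
  by have [] := comp y Cy.
exists x; rewrite !inE // ffunE /C connect0 negbK.
by rewrite tpermL.
Qed.

Lemma C3_shared_class R R' :
  C3 R R' -> exists i, forall x, (val R x == i) = (val R' x == i).
Proof.
move=> /existsP[i /existsP[j /existsP[k /existsP[x /and3P[ijk _ /forallP RR']]]]].
exists i => y; rewrite (eqP (RR' y)); case: (connect _ _ _) => //.
by rewrite tperm_avoids.
Qed.

(** A switch keeps the class of the color that it avoids, so C_3-connectedness is
    the equivalence generated by sharing a color class. This form, free of
    components, is the one that matches the tableaux. *)
Lemma connect_C3_ind (P : coloring H -> coloring H -> Prop) :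
  (forall R, P R R) -> (forall R1 R2 R3, P R1 R2 -> P R2 R3 -> P R1 R3) ->
  (forall R R' i, (forall x, (val R x == i) = (val R' x == i)) -> P R R') ->
  forall R R', connect (@C3 H) R R' -> P R R'.
Proof.
move=> P_refl P_trans P_share R R' /connectP[p + ->].
elim: p R => //= R1 p IH R /andP[/C3_shared_class[i RR1] /IH]; apply: P_trans.
exact: P_share RR1.
Qed.

Lemma connect_C3_sym R R' : connect (@C3 H) R R' -> connect (@C3 H) R' R.
Proof.
move: R R'; apply: connect_C3_ind => // [R1 R2 R3 R21 R32 | R R' i RR'].
  exact: connect_trans R32 R21.
by apply: (shared_class_connect (i := i)) => x.
Qed.

Lemma permute_proper R (s : 'S_3) : Defs.proper [ffun x => s (val R x)].
Proof.
apply/properP => x y xy; rewrite !ffunE (inj_eq perm_inj).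
by move: xy; apply/properP/(valP R).
Qed.

Definition permute R (s : 'S_3) : coloring H :=
  exist (fun c => Defs.proper c) [ffun x => s (val R x)] (permute_proper R s).

(** A transposition of colors fixes the class of the third color. *)
Lemma permute_tperm_connect R i j : connect (@C3 H) R (permute R (tperm i j)).
Proof.
have [<- | ij] := eqVneq i j.
  rewrite (_ : permute R _ = R) //; apply/val_inj/ffunP => x.
  by rewrite ffunE tperm1 perm1.
have [k kij] := third_color ij.
by apply: (shared_class_connect (i := k)) => x; rewrite ffunE tperm_avoids.
Qed.
End Colorings.

(** * Minors *)

Section Minors.
Variable G : sgraph.

(** What deletions and contractions guarantee about the map to the minor.
    Connectedness of the fibre over x is expressed by functions that are
    constant along its edges: in this form it passes to a contraction by
    comparing values across the contracted edge, and it is used on the color of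
    a column. *)
Record minor_map (H : sgraph) (pi : G -> option H) : Prop := MinorMap {
  minor_edge k l x y : adj k l -> pi k = Some x -> pi l = Some y ->
    (x == y) || adj x y;
  minor_lift_edge x y : adj x y ->
    exists k l, [/\ adj k l, pi k = Some x & pi l = Some y];
  minor_connected x (T : Type) (f : G -> T) :
    (forall k l, adj k l -> pi k = Some x -> pi l = Some x -> f k = f l) ->
    forall k l, pi k = Some x -> pi l = Some x -> f k = f l;
  minor_onto x : exists k, pi k = Some x
}.

Lemma minor_map_self : @minor_map G Some.
Proof.
split=> [k l x y kl [<-] [<-] | x y xy | x T f _ k l [->] [->] | x] //.
- by rewrite kl orbT.
- by exists x, y.
- by exists x.
Qed.

Lemma delete_mapE (H : sgraph) (pi : G -> option H) (v : H) k x :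
  (obind (delete_map v) (pi k) = Some x) <-> (pi k = Some (val x)).
Proof.
case: (pi k) => [z|] //=; rewrite /delete_map; case: insubP => [z' zv <- | zv].
  by split=> [[->] | [/val_inj->]].
by split=> // -[zx]; rewrite zx (valP x) in zv.
Qed.

Lemma minor_map_delete (H : sgraph) (pi : G -> option H) (v : H) :
  minor_map pi -> minor_map (fun k => obind (delete_map v) (pi k)).
Proof.
move=> pi_map; split.
- move=> k l x y kl /delete_mapE kx /delete_mapE ly.
  have := minor_edge pi_map kl kx ly. by rewrite val_eqE.
- move=> x y /(minor_lift_edge pi_map)[k [l [kl kx ly]]].
  by exists k, l; split=> //; apply/delete_mapE.
- move=> x T f f_edge k l /delete_mapE kx /delete_mapE lx.
  apply: (minor_connected pi_map) kx lx => k' l' kl' kx' lx'.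
  by apply: f_edge => //; apply/delete_mapE.
- by move=> x; have [k kx] := minor_onto pi_map (val x); exists k; apply/delete_mapE.
Qed.

Lemma contract_mapE (H : sgraph) (pi : G -> option H) (u v : H) k x : u != v ->
  (obind (@contract_map H u v) (pi k) = Some x) <->
  (pi k = Some (val x) \/ val x = u /\ pi k = Some v).
Proof.
move=> uv; case: (pi k) => [z|] /=; last by split=> [| [|[]]].
rewrite /contract_map; have [-> | zv] := eqVneq z v.
  rewrite insubT /=; split=> [[<-] | [[vx] | [ux _]]]; first by right.
    by have /eqP[] := valP x; exact: esym vx.
  by congr Some; apply: val_inj.
rewrite insubT /=; split=> [[<-] | [[zx] | [_ [zv']]]]; first by left.
  by congr Some; apply: val_inj.
by case/eqP: zv.
Qed.

Lemma minor_map_contract (H : sgraph) (pi : G -> option H) (u v : H) :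
  adj u v -> minor_map pi ->
  minor_map (fun k => obind (@contract_map H u v) (pi k)).
Proof.
move=> uv_adj pi_map.
have uv : u != v by apply: contraTneq uv_adj => ->; rewrite adj_irr.
have mapE k x := contract_mapE pi k x uv.
have adjE (x y : contract u v) : adj x y = (x != y) &&
    [|| adj (val x) (val y), (val x == u) && adj v (val y) |
        (val y == u) && adj (val x) v] by [].
split.
- move=> k l x y kl /mapE kx /mapE ly; have [/val_inj-> | xy] := eqVneq (val x) (val y).
    by rewrite eqxx.
  rewrite adjE -[x == y]val_eqE (negbTE xy) orFb andTb.
  case: kx ly => [kx | [xu kx]] [ly | [yu ly]].
  + by case/orP: (minor_edge pi_map kl kx ly) => [/eqP/(elimN eqP xy) | ->].
  + case/orP: (minor_edge pi_map kl kx ly) => [/eqP xv | ]; first by have /eqP := valP x.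
    by rewrite yu eqxx /= => ->; rewrite !orbT.
  + case/orP: (minor_edge pi_map kl kx ly) => [/eqP yv | ]; first by have /eqP[] := valP y.
    by rewrite xu eqxx /= => ->; rewrite !orbT.
  + by rewrite xu yu eqxx in xy.
- move=> x y; rewrite adjE.
  move=> /andP[xy /or3P[xy' | /andP[/eqP xu vy] | /andP[/eqP yu xv]]].
  + have [k [l [kl kx ly]]] := minor_lift_edge pi_map xy'.
    by exists k, l; split=> //; apply/mapE; left.
  + have [k [l [kl kx ly]]] := minor_lift_edge pi_map vy.
    by exists k, l; split=> //; apply/mapE; [right | left].
  + have [k [l [kl kx ly]]] := minor_lift_edge pi_map xv.
    by exists k, l; split=> //; apply/mapE; [left | right].
- move=> x T f f_edge.
  have f_fiber z : (z = val x \/ val x = u /\ z = v) ->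
      forall k l, pi k = Some z -> pi l = Some z -> f k = f l.
    move=> zx; apply: (minor_connected pi_map) => k l kl kz lz.
    by apply: f_edge => //; apply/mapE; rewrite ?kz ?lz; case: zx => [|[? ]] ->; auto.
  (* The edge k0 l0 lies over u v and joins the two old fibres that merge. *)
  have [k0 [l0 [kl0 k0u l0v]]] := minor_lift_edge pi_map uv_adj.
  have cross k l : val x = u -> pi k = Some u -> pi l = Some v -> f k = f l.
    move=> xu ku lv; rewrite (f_fiber u _ k k0) ?xu; auto.
    rewrite (f_fiber v _ l l0) //; auto.
    by apply: f_edge => //; apply/mapE; rewrite xu; auto.
  move=> k l /mapE kx /mapE lx; case: kx lx => [kx | [xu kx]] [lx | [xu' lx]].
  + by apply: f_fiber kx lx; left.
  + by rewrite xu' in kx; apply: cross.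
  + by rewrite xu in lx; apply/esym/cross.
  + by apply: f_fiber kx lx; right.
- move=> x; have [k kx] := minor_onto pi_map (val x).
  by exists k; apply/mapE; left.
Qed.

Lemma minor_way_map (H : sgraph) (pi : G -> option H) :
  minor_way pi -> minor_map pi.
Proof.
elim=> {H pi} [|H pi v _ IH | H pi u v uv _ IH]; first exact: minor_map_self.
  exact: minor_map_delete.
exact: minor_map_contract.
Qed.

(** Delete the vertices without a color and contract the edges with ends of
    equal colors, as long as there are any; each step removes a vertex. *)
Lemma minor_coloring_exists (f : G -> option 'I_3) :
  exists (H : sgraph) (pi : G -> option H) (w : minor_way pi) (R : coloring H),
    forall k, f k = omap (val R) (pi k).
Proof.
suff: forall m (H : sgraph) (pi : G -> option H) (w : minor_way pi)
    (g : H -> option 'I_3), (#|H| < m)%N -> (forall k, f k = obind g (pi k)) ->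
  exists (H : sgraph) (pi : G -> option H) (w : minor_way pi) (R : coloring H),
    forall k, f k = omap (val R) (pi k).
  by apply; [exact: MinorSelf | exact: ltnSn | by []].
elim=> // m IH H pi w g H_lt fg.
have sub_lt (v : H) : (#|{: {x : H | x != v}}| < m)%N.
  rewrite card_sig -ltnS; apply: leq_trans H_lt; rewrite ltnS.
  apply: proper_card; apply/fintype.properP; split; first exact/subsetP.
  by exists v; rewrite // inE eqxx.
have [v /eqP gv | g_some] := pickP (fun v => g v == None).
  apply: (IH _ _ (MinorDelete v w) (fun x => g (val x)) (sub_lt v)) => k.
  rewrite fg; case: (pi k) => //= x; rewrite /delete_map.
  by case: insubP => [x' _ <- // | /negPn/eqP->].
have [[u v] /andP[/= uv /eqP guv] | g_proper] :=
    pickP (fun p => adj p.1 p.2 && (g p.1 == g p.2)).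
  apply: (IH _ _ (MinorContract uv w) (fun x => g (val x)) (sub_lt v)) => k.
  rewrite fg; case: (pi k) => //= x; rewrite /contract_map.
  case: eqVneq => [-> | xv]; rewrite insubT //.
  by apply: contraTneq uv => ->; rewrite adj_irr.
pose c : {ffun H -> 'I_3} := [ffun x => odflt ord0 (g x)].
have gE x : g x = Some (c x) by rewrite ffunE; have := g_some x; case: (g x).
have c_proper : Defs.proper c.
  apply/properP => x y xy; have := g_proper (x, y); rewrite /= xy !gE => /negbT.
  by [].
exists H, pi, w, (exist (fun c => Defs.proper c) c c_proper) => k.
by rewrite fg; case: (pi k) => //= x; rewrite gE.
Qed.

End Minors.

(** * Tableaux of colorings *)

Lemma enum3 : enum 'I_3 = [:: ord0; lift ord0 ord0; ord_max].
Proof. by apply: (inj_map val_inj); rewrite val_enum_ord. Qed.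

(** A permutation of the colors takes any pair of colors to any other pair with
    the same equality pattern. *)
Lemma count_color_pair (c d c' d' : 'I_3) (x y : bool) : (c == d) = (c' == d') ->
  count (fun j => ((c == j) == x) && ((d == j) == y)) (enum 'I_3) =
  count (fun j => ((c' == j) == x) && ((d' == j) == y)) (enum 'I_3).
Proof.
suff /implyP h : ((c == d) == (c' == d')) ==>
    (count (fun j => ((c == j) == x) && ((d == j) == y)) (enum 'I_3) ==
     count (fun j => ((c' == j) == x) && ((d' == j) == y)) (enum 'I_3)).
  by move=> cd; apply/eqP/h; rewrite cd.
by rewrite enum3; case: x y => [] []; move: c d c' d'; color_cases.
Qed.

Lemma count_color (c c' : 'I_3) (x : bool) :
  count (fun j => (c == j) == x) (enum 'I_3) =
  count (fun j => (c' == j) == x) (enum 'I_3).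
Proof.
have cnt d : count (fun j => (d == j) == x) (enum 'I_3) =
    count (fun j => ((d == j) == x) && ((d == j) == x)) (enum 'I_3).
  by apply: eq_count => j; rewrite andbb.
by rewrite !cnt; apply: count_color_pair; rewrite !eqxx.
Qed.

(** The row of the one in a column b that has a single one. *)
Definition color_of (b : pred 'I_3) : 'I_3 :=
  if b ord0 then ord0 else if b (lift ord0 ord0) then lift ord0 ord0 else ord_max.

Lemma color_ofP (b : pred 'I_3) : count b (enum 'I_3) = 1%N ->
  forall j, b j = (color_of b == j).
Proof.
rewrite enum3 /color_of /= => b1 j.
have bE (i : 'I_3) : b i = [|| (i == ord0) && b ord0,
    (i == lift ord0 ord0) && b (lift ord0 ord0) | (i == ord_max) && b ord_max].
  case: i => [[|[|[|//]]] i_lt] /=; rewrite ?orbF; congr b; exact: val_inj.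
rewrite bE; move: b1.
by case: (b ord0) (b (lift ord0 ord0)) (b ord_max) => [] [] [] //= _;
  move: j; color_cases.
Qed.

Section Tableaux.
Variables (n : nat) (e : rel 'I_n).
Hypotheses (e_sym : ssrbool.symmetric e) (e_irr : irreflexive e).
Let G := SGraph e_sym e_irr.
Variables (H : sgraph) (pi : G -> option H).
Hypothesis pi_map : minor_map pi.
Implicit Types (R : coloring H) (i j : 'I_3) (k l : 'I_n).

Definition triple (b : 'I_3 -> state n) : seq (state n) := map b (enum 'I_3).

Lemma count_triple (P : pred (state n)) b :
  count P (triple b) = count (fun j => P (b j)) (enum 'I_3).
Proof. by rewrite count_map. Qed.

Notation rows R := (triple (tableau_row pi R)).

Lemma tableau_row_Some R j k x :
  pi k = Some x -> tableau_row pi R j k = (val R x == j).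
Proof. by move=> kx; rewrite ffunE kx. Qed.

Lemma tableau_row_None R j k : pi k = None -> tableau_row pi R j k = true.
Proof. by move=> kx; rewrite ffunE kx. Qed.

(** The margins of a tableau along an edge record only whether its ends are
    deleted, and whether they have equal colors; both are determined by pi. *)
Lemma same_margins_tableaux R R' : same_margins e (rows R) (rows R').
Proof.
split=> [k l x y kl | k x]; rewrite !count_triple.
  case kz: (pi k) => [z|]; case lt: (pi l) => [t|].
  - under eq_count do rewrite (tableau_row_Some _ _ kz) (tableau_row_Some _ _ lt).
    under [RHS]eq_count do rewrite (tableau_row_Some _ _ kz) (tableau_row_Some _ _ lt).
    apply: count_color_pair; case/orP: (minor_edge pi_map kl kz lt) => [/eqP-> | zt].
      by rewrite !eqxx.
    have /properP/(_ _ _ zt)/negbTE-> := valP R.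
    by have /properP/(_ _ _ zt)/negbTE-> := valP R'.
  - under eq_count do rewrite (tableau_row_Some _ _ kz) (tableau_row_None _ _ lt).
    under [RHS]eq_count do rewrite (tableau_row_Some _ _ kz) (tableau_row_None _ _ lt).
    case: y => /=.
      under eq_count do rewrite andbT. under [RHS]eq_count do rewrite andbT.
      exact: count_color.
    by rewrite !(@eq_count _ _ pred0) // => j; rewrite andbF.
  - under eq_count do rewrite (tableau_row_None _ _ kz) (tableau_row_Some _ _ lt).
    under [RHS]eq_count do rewrite (tableau_row_None _ _ kz) (tableau_row_Some _ _ lt).
    case: x => //=; exact: count_color.
  - under eq_count do rewrite (tableau_row_None _ _ kz) (tableau_row_None _ _ lt).
    by under [RHS]eq_count do rewrite (tableau_row_None _ _ kz) (tableau_row_None _ _ lt).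
case kz: (pi k) => [z|].
  under eq_count do rewrite (tableau_row_Some _ _ kz).
  under [RHS]eq_count do rewrite (tableau_row_Some _ _ kz).
  exact: count_color.
under eq_count do rewrite (tableau_row_None _ _ kz).
by under [RHS]eq_count do rewrite (tableau_row_None _ _ kz).
Qed.

(** The margins force the columns of b over deleted vertices to be full and the
    others to have a single one, hence a color; these colors agree on the edges
    contracted by pi, hence on its fibres, and differ on the edges of H. *)
Lemma lift_coloring R (b : 'I_3 -> state n) :
  same_margins e (rows R) (triple b) ->
  exists R', forall j, b j = tableau_row pi R' j.
Proof.
move=> [b_edge b_vertex].
pose col (k : G) := color_of (fun j => b j k).
have bN k : pi k = None -> forall j, b j k = true.
  move=> kN j; have := b_vertex k true; rewrite !count_triple.
  under eq_count do rewrite (tableau_row_None _ _ kN) eqxx.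
  rewrite count_predT => /esym/eqP; rewrite -all_count => /allP/(_ j).
  by rewrite mem_enum => /(_ isT)/eqP.
have bS k x : pi k = Some x -> forall j, b j k = (col k == j).
  move=> kx; apply: color_ofP; have := b_vertex k true; rewrite !count_triple.
  under eq_count do rewrite (tableau_row_Some _ _ kx) eqb_id.
  under [RHS]eq_count do rewrite eqb_id.
  move=> <-; rewrite (@eq_count _ _ (pred1 (val R x))) => [|j]; last by rewrite eq_sym.
  by rewrite enumT enumP.
have count11 (c d : 'I_3) :
    count (fun j => ((c == j) == true) && ((d == j) == true)) (enum 'I_3) =
    (c == d).
  by rewrite enum3; move: c d; color_cases.
have col_edge (k l : G) x y : adj k l -> pi k = Some x -> pi l = Some y ->
    (col k == col l) = (val R x == val R y).
  move=> kl kx ly; have := b_edge k l true true kl; rewrite !count_triple.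
  under eq_count do rewrite (tableau_row_Some _ _ kx) (tableau_row_Some _ _ ly).
  under [RHS]eq_count do rewrite (bS _ _ kx) (bS _ _ ly).
  by rewrite !count11; case: (_ == _); case: (_ == _).
(* As pi is onto, the pick succeeds; any preimage gives the same color. *)
pose c : {ffun H -> 'I_3} :=
  [ffun x => if [pick k | pi k == Some x] is Some k then col k else ord0].
have cE k x : pi k = Some x -> c x = col k.
  move=> kx; rewrite ffunE; case: pickP => [l /eqP lx | /(_ k)]; last by rewrite kx eqxx.
  apply: (minor_connected pi_map) lx kx => k' l' kl' kx' lx'.
  by apply/eqP; rewrite (col_edge _ _ _ _ kl' kx' lx').
have c_proper : Defs.proper c.
  apply/properP => x y xy; have [k [l [kl kx ly]]] := minor_lift_edge pi_map xy.
  rewrite (cE _ _ kx) (cE _ _ ly) (col_edge _ _ _ _ kl kx ly).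
  by move: xy; apply/properP/(valP R).
exists (exist (fun c => Defs.proper c) c c_proper) => j; apply/ffunP => k.
case kx: (pi k) => [x|]; last by rewrite bN // tableau_row_None.
by rewrite (bS _ _ kx) (tableau_row_Some _ _ kx) /= (cE _ _ kx).
Qed.

(** As pi is onto, the row i of a tableau determines the class of the color i. *)
Lemma row_connect R R' i :
  tableau_row pi R i = tableau_row pi R' i -> connect (@C3 H) R R'.
Proof.
move=> RR'; apply: (shared_class_connect (i := i)) => x.
by have [k kx] := minor_onto pi_map x; rewrite -!(tableau_row_Some _ _ kx) RR'.
Qed.

(** Move the row equal to the first row of R into first position by a
    transposition of colors; then the first rows agree. *)
Lemma perm_tableaux_connect R R' :
  perm_eq (rows R) (rows R') -> connect (@C3 H) R R'.
Proof.
move=> RR'; have: tableau_row pi R ord0 \in rows R'.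
  by rewrite -(perm_mem RR') map_f ?mem_enum.
move=> /mapP[i _ row_eq].
apply: connect_trans (connect_C3_sym (permute_tperm_connect R' ord0 i)).
apply: (row_connect (i := ord0)); rewrite row_eq; apply/ffunP => k; rewrite !ffunE.
by case: (pi k) => // x; rewrite ffunE (canF_eq (tpermK _ _)) tpermL.
Qed.

(** A move that leaves one row of the tableau in place stays in the component
    of R. *)
Lemma tableau_exchange R (t : seq (state n)) i :
  same_margins e (rows R) t -> size t = 3 -> tableau_row pi R i \in t ->
  exists R', connect (@C3 H) R R' /\ perm_eq t (rows R').
Proof.
move=> Rt size_t row_t; set w := tableau_row pi R i in row_t.
(* The rows of t, with w in position i as in R. *)
pose b j := nth w (w :: rem w t) (tperm ord0 i j).
have t_b : perm_eq t (triple b).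
  apply: (perm_trans (perm_to_rem row_t)).
  pose f (j : 'I_3) := nth w (w :: rem w t) j.
  apply: (@perm_trans _ (map f (enum 'I_3))).
    have: size (rem w t) = 2 by rewrite size_rem // size_t.
    by rewrite enum3 /f; case: (rem w t) => [|u [|v []]].
  rewrite /triple (map_comp f (tperm ord0 i)); apply: perm_map.
  apply: uniq_perm; rewrite ?enum_uniq // ?(map_inj_uniq perm_inj) ?enum_uniq // => j.
  rewrite mem_enum inE; apply/esym/mapP.
  by exists (tperm ord0 i j); rewrite ?mem_enum ?tpermK.
have [R' R'E] := lift_coloring (same_margins_trans Rt (perm_same_margins e t_b)).
exists R'; split; last by rewrite (perm_trans t_b) // /triple (eq_map R'E).
by apply: (row_connect (i := i)); rewrite -R'E /b tpermR.
Qed.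

End Tableaux.

(** * Tableau binomials as generators *)

Section RigidMinors.
Variables (K : fieldType) (n : nat) (n_gt0 : (0 < n)%N) (e : rel 'I_n).
Hypotheses (e_sym : ssrbool.symmetric e) (e_irr : irreflexive e).
Let G := SGraph e_sym e_irr.
Variable rep : forall (H : sgraph) (pi : G -> option H),
  minor_way pi -> seq (coloring H).
Hypothesis repP : forall (H : sgraph) (pi : G -> option H) (w : minor_way pi),
  three_rigid H -> component_representatives (rep w).

Lemma tableau_binomialE (H : sgraph) (pi : G -> option H) (R R' : coloring H) :
  @tableau_binomial K n H pi R R' = 'X_[monomial (triple (tableau_row pi R))] -
                   'X_[monomial (triple (tableau_row pi R'))].
Proof. by congr (_ - _); rewrite monomialX big_map big_enum. Qed.

(** The set chi of the tableaux of the component of R is stable under the moves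
    of degree at most 2, since such a move leaves a row in place. Hence the sum
    of coefficients over chi vanishes on the ideal of these moves, but it is 1
    on the binomial. *)
Lemma tableau_binomial_minimal (H : sgraph) (pi : G -> option H)
    (R R' : coloring H) :
  minor_map pi -> ~~ connect (@C3 H) R R' ->
  minimal_generator e 3 (@tableau_binomial K n H pi R R').
Proof.
move=> pi_map RR'; set m := fun R0 : coloring H => monomial (triple (tableau_row pi R0)).
have mdeg_m R0 : mdeg (m R0) = 3 by rewrite mdeg_monomial size_map -cardE card_ord.
pose chi (u : 'X_{1..#|state n|}) :=
  [exists R0 : coloring H, connect (@C3 H) R R0 && (u == m R0)].
have chi_m R0 : chi (m R0) = connect (@C3 H) R R0.
  apply/existsP/idP => [[R1 /andP[RR1]] | RR0]; last by exists R0; rewrite RR0 eqxx.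
  rewrite eq_monomial perm_sym => /(perm_tableaux_connect pi_map).
  exact: connect_trans.
have chi_deg u : chi u -> mdeg u = 3 by move=> /existsP[R0 /andP[_ /eqP->]].
rewrite tableau_binomialE -/(m R) -/(m R'); split.
- exists (m R), (m R'); split=> //.
  by apply: contraNneq RR' => mRR'; rewrite -chi_m -mRR' chi_m connect0.
- by apply/graph_ideal_binomial => //; apply: same_margins_tableaux.
move=> /(stable_coefficient_sum_eq0 (chi := chi) chi_deg) chi0.
suff /chi0/eqP : forall a u v, fiber e u = fiber e v -> (mdeg u <= 2)%N ->
    chi (a + u)%MM -> chi (a + v)%MM.
  have m_lt R0 : (mdeg (m R0) < 4)%N by rewrite mdeg_m.
  rewrite (bigD1 (BMultinom (m_lt R))) //= chi_m connect0 mulr1.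
  rewrite big1 ?addr0 => [|u u_neq].
    rewrite mcoeffB !mcoeffX eqxx.
    have /negbTE -> : m R' != m R.
      by apply: contraNneq RR' => mRR'; rewrite -chi_m mRR' chi_m connect0.
    by rewrite subr0 oner_eq0.
  rewrite mcoeffB !mcoeffX; have [<- | _] := eqVneq (m R') u.
    by rewrite chi_m (negbTE RR') mulr0.
  case: eqP => [mu | _]; last by rewrite subrr mul0r.
  by case/eqP: u_neq; apply: val_inj.
move=> a u v uv u_deg /existsP[R0 /andP[RR0 /eqP auE]].
have perm_R0 : perm_eq (word a ++ word u) (triple (tableau_row pi R0)).
  by rewrite -eq_monomial monomial_cat !wordK auE.
have marg_R0 : same_margins e (triple (tableau_row pi R0)) (word a ++ word v).
  apply: same_margins_trans (perm_same_margins _ _) _.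
    by rewrite perm_sym; apply: perm_R0.
  by apply/same_margins_cat/fiber_eqP; rewrite ?uv.
have size_av : size (word a ++ word v) = 3.
  by rewrite -(same_margins_size n_gt0 marg_R0) size_map -cardE card_ord.
(* The tableau has three rows and the move at most two, so a row stays. *)
have [w w_a] : exists w, w \in word a.
  have: (0 < size (word a))%N.
    move: u_deg size_av; rewrite (fiber_mdeg n_gt0 e_sym e_irr uv).
    by rewrite size_cat !size_word; lia.
  by case: (word a) => // w s _; exists w; rewrite inE eqxx.
have : w \in triple (tableau_row pi R0) by rewrite -(perm_mem perm_R0) mem_cat w_a.
move=> /mapP[i _ wE].
have [|R1 [R0R1 perm_R1]] := tableau_exchange (i := i) pi_map marg_R0 size_av.
  by rewrite -wE mem_cat w_a.
apply/existsP; exists R1; rewrite (connect_trans RR0 R0R1) /m -(wordK a) -(wordK v).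
by rewrite -monomial_cat eq_monomial.
Qed.

Definition small_elements (h : {mpoly K[#|state n|]}) : Prop :=
  (exists2 f, rigid_minor_element rep f & equivalent e f h) \/
  quadratic_binomial_in_ideal e h.

Local Notation linked := (linked small_elements).

Lemma same_margins_linked2 s t : size s = 2 -> same_margins e s t -> linked s t.
Proof.
move=> s2 st; case st_perm: (perm_eq s t); first exact: perm_linked.
apply: ideal_gen; right; split; last exact/graph_ideal_binomial.
exists (monomial s), (monomial t); split=> //; rewrite ?mdeg_monomial //.
  by rewrite -(same_margins_size n_gt0 st).
by rewrite eq_monomial st_perm.
Qed.

Lemma same_margins_perm1 s t : (size s <= 1)%N -> same_margins e s t -> perm_eq s t.
Proof.
move=> s1 st; have := same_margins_size n_gt0 st.
case: s s1 st => [|w [|//]] _ st; first by case: t st.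
case: t st => [//|w' [|//]] [_ st] _; suff -> : w = w' by [].
apply/ffunP => k; have := st k (w k); rewrite /= eqxx.
by case: eqP.
Qed.

Variables (H : sgraph) (pi : G -> option H) (way : minor_way pi).
Let pi_map := minor_way_map way.
Variable c : {ffun 'I_n -> bool}.

Definition flipped_rows (R : coloring H) := map (flip c) (triple (tableau_row pi R)).

(** For colorings with a common class i the tableaux share the row i, and the
    two other rows have the same margins: a quadratic binomial. *)
Lemma connected_linked R R' :
  connect (@C3 H) R R' -> linked (flipped_rows R) (flipped_rows R').
Proof.
move: R R'; apply: connect_C3_ind => [R | R1 R2 R3 | R R' i RR'].
- exact: perm_linked.
- exact: linked_trans.
have row_i : tableau_row pi R i = tableau_row pi R' i.
  by apply/ffunP => k; rewrite !ffunE; case: (pi k).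
pose others (R0 : coloring H) :=
  map (fun j => flip c (tableau_row pi R0 j)) (rem i (enum 'I_3)).
have i_in : i \in enum 'I_3 by rewrite mem_enum.
have split_rows R0 : perm_eq (flipped_rows R0)
    ([:: flip c (tableau_row pi R0 i)] ++ others R0).
  rewrite /flipped_rows /triple -map_comp.
  exact: (perm_map (fun j => flip c (tableau_row pi R0 j)) (perm_to_rem i_in)).
apply: linked_trans (perm_linked _ (split_rows R)) _.
apply: linked_trans (linked_sym (perm_linked _ (split_rows R'))).
rewrite row_i; apply: linked_cat; apply: same_margins_linked2.
  by rewrite size_map size_rem // -cardE card_ord.
apply/(same_margins_cat e _ _ [:: flip c (tableau_row pi R' i)]).
rewrite -{1}row_i.
apply: same_margins_trans (perm_same_margins e _) _.
  by rewrite perm_sym; apply: split_rows.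
apply: same_margins_trans (perm_same_margins e (split_rows R')).
exact/same_margins_flip/same_margins_tableaux.
Qed.

(** Each coloring is linked to R_1: quadratic moves reach the representative of
    its component, and an equivalent of a chosen binomial leads to R_1. *)
Lemma colorings_linked R R' : linked (flipped_rows R) (flipped_rows R').
Proof.
have [/connected_linked // | nRR'] := boolP (connect (@C3 H) R R').
have rigid : three_rigid H by exists R, R'.
have := repP way rigid; case reps: (rep way) => [|R1 Rs] rep1; first by have := rep1 R.
have link1 R0 : linked (flipped_rows R0) (flipped_rows R1).
  have: has (connect (@C3 H) R0) (R1 :: Rs) by rewrite has_count rep1.
  move=> /hasP[R2 + R02]; rewrite inE => /predU1P[<- | R2_in].
    exact: connected_linked.
  apply: linked_trans (connected_linked R02) (linked_sym _).
  apply: ideal_gen; left; exists (@tableau_binomial K n H pi R1 R2).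
    by exists H, pi, way, R1, R2, Rs.
  exists c, 1%g; split; first by move=> j k; rewrite !perm1.
  rewrite tableau_binomialE substB !substX.
  by congr (_ - _); rewrite monomialX [LHS]big_map.
exact: linked_trans (link1 R) (linked_sym (link1 R')).
Qed.

End RigidMinors.

(** * Degree-3 fibres as colorings *)

Section Flipping.
Variables (n : nat) (e : rel 'I_n).

(** The flip after which every column has an odd number of ones. *)
Definition normalising_flip (a : 'I_3 -> state n) : {ffun 'I_n -> bool} :=
  [ffun k => ~~ odd (count (fun j => a j k) (enum 'I_3))].

Definition column_color (b : 'I_3 -> bool) : option 'I_3 :=
  if all b (enum 'I_3) then None else Some (color_of b).

Lemma column_colorP (b : 'I_3 -> bool) : odd (count b (enum 'I_3)) ->
  forall j, b j = if column_color b is Some i then i == j else true.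
Proof.
rewrite /column_color; case: allP => [b_true _ j | /allP].
  by rewrite b_true ?mem_enum.
rewrite all_count size_enum_ord => b3 b_odd; apply: color_ofP.
have := count_size b (enum 'I_3); rewrite size_enum_ord.
by move: b3 b_odd; case: (count b _) => [|[|[|[|]]]].
Qed.

Lemma flip_odd (a : 'I_3 -> state n) k :
  odd (count (fun j => flip (normalising_flip a) (a j) k) (enum 'I_3)).
Proof.
under eq_count do rewrite flipE ffunE.
by rewrite enum3 /=; do 3 case: (a _ k).
Qed.
End Flipping.

Theorem proposition4p13 (R : realType) (n : nat) (n_gt0 : (0 < n)%N)
    (e : rel 'I_n) (e_sym : ssrbool.symmetric e) (e_irr : irreflexive e)
    (rep : forall (H : sgraph) (pi : SGraph e_sym e_irr -> option H),
        minor_way pi -> seq (coloring H))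
    (repP : forall (H : sgraph) (pi : SGraph e_sym e_irr -> option H)
        (w : minor_way pi),
        three_rigid H -> component_representatives (rep H pi w)) :
  (forall f : {mpoly R[i][#|state n|]},
      rigid_minor_element rep f -> minimal_generator e 3 f) /\
  (forall g : {mpoly R[i][#|state n|]},
      graph_ideal e g -> (msize g <= 4)%N ->
      generated_ideal
        (fun h => (exists2 f, rigid_minor_element rep f & equivalent e f h) \/
                  quadratic_binomial_in_ideal e h)
        g).
Proof.
split=> [f [H [pi [w [R1 [R2 [Rs [rigid reps R2_in ->]]]]]]] | g].
  apply: tableau_binomial_minimal => //; first exact: minor_way_map.
  apply/negP => R12; have := repP _ _ w rigid R1; rewrite reps /= connect0 add1n => -[].
  by apply/eqP; rewrite -leqn0 -ltnNge -has_count; apply/hasP; exists R2.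
apply: linked_generate => // s t s3 st.
have [s_lt | ] := ltnP (size s) 2.
  exact: perm_linked (same_margins_perm1 n_gt0 s_lt st).
rewrite leq_eqVlt => /orP[/eqP s2 | s_gt].
  exact: same_margins_linked2.
have {s3 s_gt} s3 : size s = 3 by apply/eqP; rewrite eqn_leq s3.
have t3 : size t = 3 by rewrite -(same_margins_size n_gt0 st).
pose w0 : state n := [ffun=> true].
have tripleE u : size u = 3 -> u = triple (fun j : 'I_3 => nth w0 u j).
  by rewrite /triple enum3; case: u => [|? [|? [|? []]]].
pose a (j : 'I_3) := nth w0 s j; pose b (j : 'I_3) := nth w0 t j.
have sE : s = triple a := tripleE s s3; have tE : t = triple b := tripleE t t3.
rewrite {}sE {}tE in st *; move: (a) (b) st => {s t s3 t3 tripleE} {}a {}b st.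
pose c := normalising_flip a.
have [H [pi [w [R1 aR1]]]] := minor_coloring_exists (G := SGraph e_sym e_irr)
  (fun k => column_color (fun j => flip c (a j) k)).
have flip_a j : flip c (a j) = tableau_row pi R1 j.
  apply/ffunP => k; rewrite (column_colorP (flip_odd a k)) aR1 [RHS]ffunE.
  by case: (pi k).
have st_flip : same_margins e (triple (tableau_row pi R1))
    (triple (fun j => flip c (b j))).
  have := same_margins_flip c st; rewrite /triple -!map_comp.
  by rewrite (eq_map (f := flip c \o a) flip_a).
have [R2 flip_b] := lift_coloring (minor_way_map w) st_flip.
have unflip (a' : 'I_3 -> state n) R0 :
    (forall j, flip c (a' j) = tableau_row pi R0 j) ->
    triple a' = flipped_rows pi c R0.
  move=> a'E; rewrite /flipped_rows /triple -map_comp; apply: eq_map => j /=.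
  by rewrite -a'E flipK.
rewrite (unflip a R1) // (unflip b R2) //.
exact: colorings_linked.
Qed.
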